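(* If the bound-tightening algorithm described in the context is run with $\varepsilon=0$, then it either stops after a finite number of iterations returning $z,y$, or generates two infinite sequences $\{u^k\}$ and $\{l^k\}$, the former converging from above to $z$, the latter converging from below to $y$.
   Context: Let $n\ge 3$, let $h,M,P_{\max},g,\mu,\gamma>0$, $c\ge 0$, and $\alpha_1,\dots,\alpha_{n-1}\in(-\pi/2,\pi/2)$. Let $\hat w_i>0$ solve $\frac{P_{\max}}{M\sqrt{2\hat w_i}}=g\mu\cos\alpha_i$; standing assumption on $h$: $1-h\gamma-h\frac{P_{\max}}{M(2\hat w_i)^{3/2}}\ge 0$ for all $i\in\{1,\dots,n-1\}$. Put $\theta_i=g(\sin\alpha_i+c\cos\alpha_i)$, and let $\beta_i(w)=\min\{\frac{P_{\max}}{M\sqrt{2w}},g\mu\cos\alpha_i\}$, that is, $\beta_i(w)=g\mu\cos\alpha_i$ for $w\le\hat w_i$ and $\beta_i(w)=\frac{P_{\max}}{M\sqrt{2w}}$ for $w>\hat w_i$. Put $\ell_i(w)=(1-h\gamma)w+h\beta_i(w)$. Let $w_{\rm in},w_{\rm fin}\ge 0$, let $w^{\max}\in\mathbb{R}^n$ have nonnegative entries with $w^{\max}_1=w_{\rm in}$, $w^{\max}_n=w_{\rm fin}$, and let $w^{\min}\in\mathbb{R}^n$ with $w^{\min}_1=w_{\rm in}$, $w^{\min}_n=w_{\rm fin}$, $w^{\min}_i=0$ otherwise. For $w\in\mathbb{R}^n$ put $f_i(w)=\frac1h(w_{i+1}-w_i)+\gamma w_i+\theta_i$. With $i$ ranging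 over $\{1,\dots,n-1\}$ and vector inequalities componentwise, define $X_1=\{w: f_i(w)\le\beta_i(w_i)\ \forall i,\ w\ge w^{\min}\}$, $X_2=\{w: f_i(w)\le\beta_i(w_i)\ \forall i,\ w\le w^{\max}\}$, $X_3=\{w: f_i(w)\ge-g\mu\cos\alpha_i\ \forall i,\ w\ge w^{\min}\}$, $X_4=\{w: f_i(w)\ge-g\mu\cos\alpha_i\ \forall i,\ w\le w^{\max}\}$, $X=X_1\cap X_2\cap X_3\cap X_4$, and $z_i=\max_{w\in X_2\cap X_4}w_i$, $y_i=\min_{w\in X_1\cap X_3}w_i$ for $i\in\{1,\dots,n\}$. Define maps on vectors (with $j\in\{1,\dots,n-1\}$): $B_1(u)=p$: $p_1=u_1$, $p_{j+1}=\min\{u_{j+1},\ \ell_j(p_j)-h\theta_j\}$; $B_2(u)=p$: $p_n=u_n$, $p_j=\min\{u_j,\ \frac{p_{j+1}+h\theta_j+hg\mu\cos\alpha_j}{1-h\gamma}\}$; $B_3(l)=p$: $p_n=l_n$, $p_j=$ the smallest $w\ge l_j$ with $\ell_j(w)\ge p_{j+1}+h\theta_j$; $B_4(l)=p$: $p_1=l_1$, $p_{j+1}=\max\{l_{j+1},\ (1-h\gamma)p_j-h\theta_j-hg\mu\cos\alpha_j\}$. Algorithm: start with $u^1=w^{\max}$, $l^1=w^{\min}$. At iteration $k=1,2,\dots$ compute $u^{k+1}=B_2(B_1(u^k))$ and $l^{k+1}=B_4(B_3(l^k))$. If $\|u^{k+1}-u^k\|\le\varepsilon$ and $\|l^{k+1}-l^k\|\le\varepsilon$,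 stop and return $u^{k+1},l^{k+1}$; otherwise, if $u^{k+1}\not\ge l^{k+1}$ (componentwise), it is established that $X=\varnothing$; otherwise continue with $k+1$.
   Formalization: If the run ends when it establishes that X is empty, the two stated outcomes are not exhaustive; that ending is then added as a third outcome, occurring only if X is indeed empty. If the run instead continues past that test, the two stated outcomes are asserted unchanged. *)

(* Defs.v *)
From HB Require Import structures.
From mathcomp Require Import all_boot all_order all_algebra.
From mathcomp Require Import all_classical all_reals all_analysis.

Set Implicit Arguments.
Unset Strict Implicit.
Unset Printing Implicit Defensive.

Import Order.TTheory GRing.Theory Num.Theory.
Import numFieldNormedType.Exports.

Local Open Scope classical_set_scope.
Local Open Scope ring_scope.

(* R^n is 'rV[R]_m.+2 with n = m.+2. The point index 1, ..., n is an element
   of 'I_m.+2 and the stage index 1, ..., n-1 an element of 'I_m.+1, both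
   shifted down by one; stage i joins the points lo i ("i") and hi i ("i+1"). *)
Definition lo m (i : 'I_m.+1) : 'I_m.+2 := widen_ord (leqnSn m.+1) i.
Definition hi m (i : 'I_m.+1) : 'I_m.+2 := lift ord0 i.

(* Raw data only: sign conditions and the equation defining what are
   hypotheses of the theorem. *)
Record problem (R : realType) (m : nat) := Problem {
  h : R;
  M : R;
  Pmax : R;
  g : R;
  mu : R;
  gamma : R;
  c : R;
  alpha : 'I_m.+1 -> R;
  what : 'I_m.+1 -> R;
  win : R;
  wfin : R;
  wmax : 'rV[R]_m.+2
}.

Section Sweeps.
Context {R : realType} {m : nat}.
Implicit Types (x : R) (step : 'I_m.+1 -> R -> R).

Fixpoint forward x step (j : nat) : R :=
  if j is j'.+1 then step (inord j') (forward x step j') else x.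

(* backward x step k is the entry k places before the last one. *)
Fixpoint backward x step (k : nat) : R :=
  if k is k'.+1 then step (inord (m - k')) (backward x step k') else x.

Definition sweep_up x step : 'rV[R]_m.+2 := \row_i forward x step i.
Definition sweep_down x step : 'rV[R]_m.+2 :=
  \row_i backward x step (m.+1 - i).

Lemma sweep_up_first x step : sweep_up x step 0 ord0 = x.
Proof. by rewrite mxE. Qed.

Lemma sweep_up_next x step (j : 'I_m.+1) :
  sweep_up x step 0 (hi j) = step j (sweep_up x step 0 (lo j)).
Proof. by rewrite !mxE /= inord_val. Qed.

Lemma sweep_down_last x step : sweep_down x step 0 ord_max = x.
Proof. by rewrite mxE /= subnn. Qed.

Lemma sweep_down_prev x step (j : 'I_m.+1) :
  sweep_down x step 0 (lo j) = step j (sweep_down x step 0 (hi j)).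
Proof.
rewrite !mxE /= /bump /= add1n subSS subSn; last by rewrite -ltnS.
rewrite /= subKn ?inord_val //; by rewrite -ltnS.
Qed.

End Sweeps.

Definition is_max {R : realType} (A : set R) : set R := A `&` ubound A.
Definition is_min {R : realType} (A : set R) : set R := A `&` lbound A.

Definition vle {R : realType} {n : nat} (v w : 'rV[R]_n) : bool :=
  [forall i, v 0 i <= w 0 i].

Section Problem.
Context {R : realType} {m : nat} (P : problem R m).

Local Notation h := (h P).
Local Notation gamma := (gamma P).
Implicit Types (i j : 'I_m.+1) (u l v w : 'rV[R]_m.+2).

Definition theta i : R := g P * (sin (alpha P i) + c P * cos (alpha P i)).

Definition grip i : R := g P * mu P * cos (alpha P i).

(* The case form of min {Pmax / (M sqrt (2 x)), g mu cos alpha_i}: the literal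
   min would be wrong for x <= 0, where Num.sqrt and division are totalized
   and the first term is 0 instead of +oo. *)
Definition beta i (x : R) : R :=
  if x <= what P i then grip i else Pmax P / (M P * Num.sqrt (2 * x)).

Definition ell i (x : R) : R := (1 - h * gamma) * x + h * beta i x.

Definition wmin : 'rV[R]_m.+2 :=
  \row_(k < m.+2)
    if k == ord0 then win P else if k == ord_max then wfin P else 0.

Definition f i w : R :=
  h^-1 * (w 0 (hi i) - w 0 (lo i)) + gamma * w 0 (lo i) + theta i.

Definition X1 : set 'rV[R]_m.+2 :=
  [set w | (forall i, f i w <= beta i (w 0 (lo i))) /\ vle wmin w].
Definition X2 : set 'rV[R]_m.+2 :=
  [set w | (forall i, f i w <= beta i (w 0 (lo i))) /\ vle w (wmax P)].
Definition X3 : set 'rV[R]_m.+2 :=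
  [set w | (forall i, - grip i <= f i w) /\ vle wmin w].
Definition X4 : set 'rV[R]_m.+2 :=
  [set w | (forall i, - grip i <= f i w) /\ vle w (wmax P)].
Definition X : set 'rV[R]_m.+2 := X1 `&` X2 `&` X3 `&` X4.

Definition B1 u : 'rV[R]_m.+2 :=
  sweep_up (u 0 ord0) (fun j p =>
    Num.min (u 0 (hi j)) (ell j p - h * theta j)).

Definition B2 u : 'rV[R]_m.+2 :=
  sweep_down (u 0 ord_max) (fun j p =>
    Num.min (u 0 (lo j)) ((p + h * theta j + h * grip j) / (1 - h * gamma))).

(* The default value 0 of xget is irrelevant: under the standing assumption on
   h each ell j is continuous, increasing and unbounded, so the least element
   exists. *)
Definition B3 l : 'rV[R]_m.+2 :=
  sweep_down (l 0 ord_max) (fun j p =>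
    xget 0 (is_min [set x | l 0 (lo j) <= x /\ p + h * theta j <= ell j x])).

Definition B4 l : 'rV[R]_m.+2 :=
  sweep_up (l 0 ord0) (fun j p =>
    Num.max (l 0 (hi j)) ((1 - h * gamma) * p - h * theta j - h * grip j)).

Variant state :=
  | Running of 'rV[R]_m.+2 & 'rV[R]_m.+2
  | Returned of 'rV[R]_m.+2 & 'rV[R]_m.+2
  | DeclaredEmpty.

(* halt says whether the run ends as soon as X has been found to be empty, or
   goes on computing the bounds. *)
Definition iteration (halt : bool) (eps : R) u l : state :=
  let u' := B2 (B1 u) in
  let l' := B4 (B3 l) in
  if (`|u' - u| <= eps) && (`|l' - l| <= eps) then Returned u' l'
  else if halt && ~~ vle l' u' then DeclaredEmpty
  else Running u' l'.

(* State after k iterations; the iterates numbered 1 are the initial ones, so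
   the pair numbered k.+1 is held after k iterations. *)
Fixpoint algorithm (halt : bool) (eps : R) (k : nat) : state :=
  if k is k'.+1 then
    match algorithm halt eps k' with
    | Running u l => iteration halt eps u l
    | s => s
    end
  else Running (wmax P) wmin.

End Problem.

Arguments DeclaredEmpty {R m}.

(* Main.v *)
(* The constraints on w read w_{i+1} <= A_i(w_i) and w_i <= C_i(w_{i+1}) with
   A_i(x) = ell_i(x) - h theta_i and C_i continuous and nondecreasing; for A_i
   this is the standing assumption on h, since the slope of beta_i on
   [what_i, +oo) is least at what_i.  Hence each sweep maps a vector that
   bounds all the feasible ones to a tighter bound with the same property, and
   the iterates are monotone.  By continuity their limit satisfies all the
   constraints, so it is the extreme feasible vector.  A fixed iterate is the
   limit of a constant sequence. *)

Require Import Defs.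
From HB Require Import structures.
From mathcomp Require Import all_boot all_order all_algebra.
From mathcomp Require Import all_classical all_reals all_analysis.
From mathcomp Require Import ring lra.

Set Implicit Arguments.
Unset Strict Implicit.
Unset Printing Implicit Defensive.

Import Order.TTheory GRing.Theory Num.Theory.
Import numFieldNormedType.Exports.

Local Open Scope classical_set_scope.
Local Open Scope ring_scope.

(** * Componentwise order and monotone convergence of vectors *)

Section VectorOrder.
Context {R : realType} {n : nat}.
Implicit Types (s u v w z : 'rV[R]_n) (x : nat -> 'rV[R]_n).

Lemma vleP v w : reflect (forall i, v 0 i <= w 0 i) (vle v w).
Proof. exact: forallP. Qed.

Lemma vle_refl v : vle v v.
Proof. exact/vleP. Qed.

Lemma vle_trans v u w : vle u v -> vle v w -> vle u w.
Proof.
by move=> /vleP uv /vleP vw; apply/vleP => i; apply: le_trans (vw i).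
Qed.

Lemma vle_anti u v : vle u v -> vle v u -> u = v.
Proof.
move=> /vleP uv /vleP vu; apply/rowP => i.
by apply/eqP; rewrite eq_le uv vu.
Qed.

Lemma vleN u v : vle (- u) (- v) = vle v u.
Proof. by apply: eq_forallb => i; rewrite !mxE lerN2. Qed.

Lemma cvg_rV x z : (forall i, x k 0 i @[k --> \oo] --> z 0 i) ->
  x k @[k --> \oo] --> z.
Proof.
move=> xz; apply/cvgrPdist_le => e e0.
have near_z i : \forall k \near \oo, `|z 0 i - x k 0 i| <= e.
  by move/cvgrPdist_le : (xz i); apply.
(* There are finitely many coordinates, so one rank serves them all; the norm is the largest
   absolute entry. *)
have : \forall k \near \oo, forall i, `|z 0 i - x k 0 i| <= e.
  exact: filter_forall.
apply: filterS => k xk.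
rewrite /Num.norm /= mx_normrE; apply: bigmax_le => [|[i j] _]; first exact: ltW.
by rewrite !mxE /= ord1.
Qed.

(** Monotone convergence in each coordinate yields some limit [s], and [z] below the sequence gives
    [z <= s]. The last hypothesis supplies the converse; it will hold because limits are feasible
    and [z] bounds every feasible vector. *)
Lemma cvg_nonincreasing_rV x z :
    (forall k, vle (x k.+1) (x k)) -> (forall k, vle z (x k)) ->
    (forall s, (forall i, x k 0 i @[k --> \oo] --> s 0 i) -> vle s z) ->
  x k @[k --> \oo] --> z.
Proof.
move=> x_dec zx lim_le.
have xi_dec i : nonincreasing_seq (fun k => x k 0 i).
  by apply/nonincreasing_seqP => k; apply: (vleP _ _ (x_dec k)).
have xi_cvg i : cvgn (fun k => x k 0 i).
  apply: nonincreasing_is_cvgn => //; exists (z 0 i) => _ [k _ <-].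
  exact: (vleP _ _ (zx k)).
pose s : 'rV[R]_n := \row_i limn (fun k => x k 0 i).
have xs i : x k 0 i @[k --> \oo] --> s 0 i by rewrite mxE; apply: xi_cvg.
have <- : s = z.
  apply: vle_anti; first exact: lim_le.
  apply/vleP => i; rewrite mxE; apply: limr_ge => //.
  by apply: nearW => k; apply: (vleP _ _ (zx k)).
exact: cvg_rV.
Qed.

Lemma cvg_nondecreasing_rV x z :
    (forall k, vle (x k) (x k.+1)) -> (forall k, vle (x k) z) ->
    (forall s, (forall i, x k 0 i @[k --> \oo] --> s 0 i) -> vle z s) ->
  x k @[k --> \oo] --> z.
Proof.
move=> x_inc xz lim_ge.
rewrite -[z]opprK -[X in X @ _]opprK; apply: cvgN.
apply: cvg_nonincreasing_rV => [k|k|s xs]; rewrite ?vleN //.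
rewrite -[s]opprK vleN; apply: lim_ge => i; rewrite mxE.
rewrite (_ : (fun k => _) = \- (fun k => (\- x) k 0 i)).
  exact: cvgN.
by apply/funext => k /=; rewrite mxE opprK.
Qed.

End VectorOrder.

(** * Induction in the order of the sweeps *)

Section SweepInduction.
Context {m : nat}.

Lemma hiP (Q : 'I_m.+2 -> Prop) :
  Q ord0 -> (forall j, Q (hi j)) -> forall k, Q k.
Proof.
move=> Q0 Qhi k; have [j ->|->] := unliftP ord0 k; last by [].
exact: Qhi.
Qed.

Lemma loP (Q : 'I_m.+2 -> Prop) :
  Q ord_max -> (forall j, Q (lo j)) -> forall k, Q k.
Proof.
move=> Qmax Qlo k; have [j ->|->] := unliftP ord_max k; last by [].
suff -> : lift ord_max j = lo j by [].
by apply: val_inj; rewrite /= /bump leqNgt ltn_ord add0n.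
Qed.

Lemma lohi_ind (Q : 'I_m.+2 -> Prop) :
  Q ord0 -> (forall j, Q (lo j) -> Q (hi j)) -> forall k, Q k.
Proof.
move=> Q0 QS [k lt_k]; elim: k lt_k => [|k IHk] lt_k.
  by rewrite (_ : Ordinal lt_k = ord0) //; apply: val_inj.
rewrite (_ : Ordinal lt_k = hi (Ordinal (lt_k : (k < m.+1)%N))).
  by apply: QS; rewrite (_ : lo _ = Ordinal (ltnW lt_k)) //; apply: val_inj.
exact: val_inj.
Qed.

Lemma hilo_ind (Q : 'I_m.+2 -> Prop) :
  Q ord_max -> (forall j, Q (hi j) -> Q (lo j)) -> forall k, Q k.
Proof.
move=> Qmax QP k.
(* The induction runs on the distance to the last index, as [sweep_down] does. *)
suff Qd d : forall i : 'I_m.+2, (m.+1 - i = d)%N -> Q i by exact: Qd.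
elim: d => [i|d IHd]; last first.
  elim/loP => [|j eq_d]; first by rewrite subnn.
  apply: QP; apply: IHd; rewrite /= /bump /= add1n subSS.
  have le_j : (j <= m)%N := ltn_ord j.
  by move: eq_d; rewrite /= subSn // => -[].
move/eqP; rewrite subn_eq0 => lt_i.
rewrite (_ : i = ord_max) //; apply: val_inj; apply/eqP.
by rewrite eqn_leq lt_i -ltnS ltn_ord.
Qed.

End SweepInduction.

(** * Growth of [beta] and [ell] *)

(** With [x = t ^+ 2 / 2], the function [t^-1 = (2 x)^(-1/2)] is convex in [x] with slope [- t^-3],
    so beyond [r] no chord is steeper than the tangent at [r]. *)
Lemma inv_chord_le (R : realFieldType) (r s t : R) :
  0 < r -> r <= s -> s <= t ->
  s^-1 - t^-1 <= (t ^+ 2 / 2 - s ^+ 2 / 2) / r ^+ 3.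
Proof.
move=> r0 rs st.
have s0 : 0 < s := lt_le_trans r0 rs.
have t0 : 0 < t := lt_le_trans s0 st.
(* First the tangent at the left endpoint [s]: clearing denominators leaves
   [s ^+ 2 <= (t + s) * t / 2]. Moving from [s] down to [r] only weakens the bound. *)
have : s^-1 - t^-1 <= (t ^+ 2 / 2 - s ^+ 2 / 2) / s ^+ 3.
  rewrite ler_pdivlMr ?exprn_gt0 //.
  have -> : (s^-1 - t^-1) * s ^+ 3 = (t - s) * s ^+ 2 / t.
    by field; rewrite !gt_eqF.
  rewrite ler_pdivrMr //.
  have -> : (t ^+ 2 / 2 - s ^+ 2 / 2) * t = (t - s) * ((t + s) * t / 2) by field.
  by apply: ler_wpM2l; nra.
move/le_trans; apply; apply: ler_wpM2l.
  by rewrite subr_ge0 ler_pM2r ?invr_gt0 // ler_pXn2r // nnegrE ltW.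
by rewrite lef_pV2 ?posrE ?exprn_gt0 // ler_pXn2r // nnegrE ltW.
Qed.

Lemma powR32 (R : realType) (x : R) : 0 <= x -> x `^ (3 / 2) = Num.sqrt x ^+ 3.
Proof. by move=> x0; rewrite mulrC powRrM powR12_sqrt // powR_mulrn. Qed.

Section Bounds.
Context {R : realType} {m : nat} (P : problem R m).
Implicit Types (j : 'I_m.+1) (u l v w s : 'rV[R]_m.+2).

Local Notation h := (h P).
Local Notation K := (1 - h * gamma P).

(** The two families of inequalities on [f], solved for the later entry; this is the form that the
    sweeps enforce. *)
Definition accel_ok w : Prop :=
  forall j, w 0 (hi j) <= ell P j (w 0 (lo j)) - h * theta P j.

Definition decel_ok w : Prop :=
  forall j, K * w 0 (lo j) - h * theta P j - h * grip P j <= w 0 (hi j).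

Context (h_gt0 : 0 < h) (M_gt0 : 0 < M P) (Pmax_gt0 : 0 < Pmax P).
Context (what_gt0 : forall i, 0 < what P i).
Context (whatE : forall i, Pmax P / (M P * Num.sqrt (2 * what P i)) = grip P i).
Context (h_small : forall i,
  0 <= K - h * (Pmax P / (M P * (2 * what P i) `^ (3 / 2)))).

Lemma accel_okP w : (forall i, f P i w <= beta P i (w 0 (lo i))) <-> accel_ok w.
Proof.
suff E i : (f P i w <= beta P i (w 0 (lo i)))
    = (w 0 (hi i) <= ell P i (w 0 (lo i)) - h * theta P i).
  by split=> H i; have := H i; rewrite E.
rewrite -(ler_pM2l h_gt0) /f /ell -subr_ge0 -[RHS]subr_ge0; congr (0 <= _).
by field; rewrite gt_eqF.
Qed.

Lemma decel_okP w : (forall i, - grip P i <= f P i w) <-> decel_ok w.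
Proof.
suff E i : (- grip P i <= f P i w)
    = (K * w 0 (lo i) - h * theta P i - h * grip P i <= w 0 (hi i)).
  by split=> H i; have := H i; rewrite E.
rewrite -(ler_pM2l h_gt0) /f -subr_ge0 -[RHS]subr_ge0; congr (0 <= _).
by field; rewrite gt_eqF.
Qed.

Lemma grip_gt0 i : 0 < grip P i.
Proof. by rewrite -whatE divr_gt0 // mulr_gt0 // sqrtr_gt0 // mulr_gt0. Qed.

(** Strict, since the standing assumption puts a positive quantity below [K]. *)
Lemma K_gt0 : 0 < K.
Proof.
apply: lt_le_trans (_ : h * (Pmax P / (M P * (2 * what P ord0) `^ (3 / 2))) <= _).
  by rewrite mulr_gt0 // divr_gt0 // mulr_gt0 // powR_gt0 // mulr_gt0.
by rewrite -subr_ge0.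
Qed.

Lemma beta_power i (x : R) :
  what P i <= x -> beta P i x = Pmax P / (M P * Num.sqrt (2 * x)).
Proof.
rewrite /beta le_eqVlt => /predU1P[<-|lt_x]; first by rewrite lexx whatE.
by rewrite leNgt lt_x.
Qed.

Lemma beta_ge0 i (x : R) : 0 <= beta P i x.
Proof.
rewrite /beta; case: ifP => _; first exact/ltW/grip_gt0.
by rewrite divr_ge0 ?mulr_ge0 ?sqrtr_ge0 // ltW.
Qed.

(** The left bound says that [beta] is nonincreasing and makes [ell] [K]-Lipschitz; the right one
    makes [ell] nondecreasing. *)
Lemma ell_beta_diff i (x y : R) : x <= y ->
  0 <= h * (beta P i x - beta P i y) <= K * (y - x).
Proof.
have high a b : what P i <= a -> a <= b ->
    0 <= h * (beta P i a - beta P i b) <= K * (b - a).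
  move=> wa ab; rewrite !beta_power //; last exact: le_trans ab.
  have a0 : 0 < a := lt_le_trans (what_gt0 i) wa.
  have b0 : 0 < b := lt_le_trans a0 ab.
  pose rt (t : R) := Num.sqrt (2 * t).
  have rt_gt0 t : 0 < t -> 0 < rt t by move=> t0; rewrite sqrtr_gt0 // mulr_gt0.
  have rt_le t t' : t <= t' -> rt t <= rt t'.
    by move=> tt'; rewrite ler_wsqrtr // ler_pM2l.
  have rt_sqr t : 0 < t -> rt t ^+ 2 / 2 = t.
    by move=> t0; rewrite sqr_sqrtr ?mulr_ge0 ?ltW // mulrAC divff ?mul1r.
  (* The base point [r] is the root at [what P i], where the power branch is steepest and where the
     standing assumption is stated. *)
  have := inv_chord_le (rt_gt0 _ (what_gt0 i)) (rt_le _ _ wa) (rt_le _ _ ab).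
  rewrite !rt_sqr // => chord.
  have hPM : 0 < h * Pmax P / M P by rewrite divr_gt0 // mulr_gt0.
  have -> : h * (Pmax P / (M P * rt a) - Pmax P / (M P * rt b))
      = h * Pmax P / M P * ((rt a)^-1 - (rt b)^-1).
    by field; rewrite !gt_eqF ?rt_gt0.
  rewrite mulr_ge0 ?(ltW hPM) //=; last first.
    by rewrite subr_ge0 lef_pV2 ?posrE ?rt_gt0 // rt_le.
  have /le_trans := ler_wpM2l (ltW hPM) chord; apply.
  have two_what_ge0 : 0 <= 2 * what P i by rewrite ltW // mulr_gt0.
  have := h_small i; rewrite powR32 // -/(rt _) subr_ge0.
  move=> /(ler_wpM2r (_ : 0 <= b - a)); rewrite subr_ge0 => /(_ ab).
  apply: le_trans; rewrite le_eqVlt; apply/orP; left; apply/eqP.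
  by rewrite /rt; field; rewrite !gt_eqF ?rt_gt0.
have low a b : a <= b -> b <= what P i ->
    0 <= h * (beta P i a - beta P i b) <= K * (b - a).
  move=> ab bw; rewrite /beta bw (le_trans ab bw) subrr mulr0 lexx /=.
  by rewrite mulr_ge0 ?(ltW K_gt0) // subr_ge0.
(* An interval straddling [what P i] is cut there; both branches of [beta] agree at that point. *)
move=> xy; have [wx|/ltW xw] := leP (what P i) x; first exact: high.
have [yw|/ltW wy] := leP y (what P i); first exact: low.
have /andP[l1 l2] := low _ _ xw (lexx _).
have /andP[h1 h2] := high _ _ (lexx _) wy.
have -> : h * (beta P i x - beta P i y) =
  h * (beta P i x - beta P i (what P i)) + h * (beta P i (what P i) - beta P i y).
  by ring.
rewrite addr_ge0 //=; apply: le_trans (lerD l2 h2) _.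
by rewrite -mulrDr ler_pM2l ?K_gt0 //; lra.
Qed.

Lemma ell_homo i : {homo ell P i : x y / x <= y}.
Proof.
by move=> x y /(ell_beta_diff i)/andP[_]; rewrite /ell; lra.
Qed.

Lemma ell_lipschitz i (x y : R) : `|ell P i x - ell P i y| <= K * `|x - y|.
Proof.
wlog xy : x y / x <= y.
  by move=> H; have [/H//|/ltW/H] := leP x y; rewrite distrC (distrC y).
rewrite ler0_norm ?subr_le0 ?ell_homo // ler0_norm ?subr_le0 //.
by have /andP[] := ell_beta_diff i xy; rewrite /ell; lra.
Qed.

Lemma ell_continuous i : continuous (ell P i).
Proof.
move=> x; apply/cvgrPdist_le => e e0.
have eK : 0 < e / K by rewrite divr_gt0 ?K_gt0.
have /cvgrPdist_le/(_ _ eK) := @cvg_id R (nbhs (x : R)).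
apply: filterS => y xy; apply: (le_trans (ell_lipschitz i x y)).
by rewrite mulrC -ler_pdivlMr ?K_gt0.
Qed.

Lemma ell_min_exists i (x q : R) :
  is_min [set t | x <= t /\ q <= ell P i t] !=set0.
Proof.
set S := [set t | _].
have S0 : S !=set0.
  (* At [q / K] the linear term of [ell] already equals [q], and [beta] is nonnegative. *)
  exists (Num.max x (q / K)); split; first by rewrite le_max lexx.
  apply: le_trans (ell_homo i (_ : q / K <= _)); last by rewrite le_max lexx orbT.
  by rewrite /ell mulrC divfK ?gt_eqF ?K_gt0 // lerDl mulr_ge0 ?beta_ge0 ?ltW.
have Sx : lbound S x by move=> t [].
have Slb : has_lbound S by exists x.
exists (inf S); split; last by move=> t; apply: ge_inf.
split; first exact: lb_le_inf.
(* If [ell] fell short of [q] at the infimum, a member of [S] closer than the gap divided by [K]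
   would, by the Lipschitz bound, fall short too. *)
rewrite leNgt; apply/negP => lt_q.
have [|t St t_lt] := @inf_adherent _ S ((q - ell P i (inf S)) / K) _ (conj S0 Slb).
  by rewrite divr_gt0 ?K_gt0 // subr_gt0.
have : ell P i t - ell P i (inf S) <= K * (t - inf S).
  have inft : inf S <= t by apply: ge_inf.
  rewrite -[t - _]ger0_norm ?subr_ge0 //.
  exact: le_trans (ler_norm _) (ell_lipschitz i t (inf S)).
move: t_lt; rewrite -ltrBlDl ltr_pdivlMr ?K_gt0 // mulrC => t_lt.
by case: St => _ qt; lra.
Qed.

(** * The four sweeps as extremal bounds *)

(** Existence of the minimum rules out the default of [xget], so later arguments never meet it. *)
Lemma B3_step l j :
  let p := B3 P l in
  [/\ l 0 (lo j) <= p 0 (lo j),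
      p 0 (hi j) + h * theta P j <= ell P j (p 0 (lo j)) &
      forall t, l 0 (lo j) <= t -> p 0 (hi j) + h * theta P j <= ell P j t ->
        p 0 (lo j) <= t].
Proof.
move=> p; rewrite /p /B3 sweep_down_prev -/(B3 P l) -/p.
case: xgetP => [t _ [[lt qt] t_min]|none].
  by split=> // t' lt' qt'; apply: t_min.
by have [t /none] := ell_min_exists j (l 0 (lo j)) (p 0 (hi j) + h * theta P j).
Qed.

Lemma B1_le u : vle (B1 P u) u.
Proof.
apply/vleP; apply: hiP => [|j]; first by rewrite sweep_up_first.
by rewrite sweep_up_next ge_min lexx.
Qed.

Lemma B1_accel u : accel_ok (B1 P u).
Proof. by move=> j; rewrite sweep_up_next ge_min lexx orbT. Qed.

(** Monotonicity of [ell] carries the comparison forward. With [B1_le] and [B1_accel], this makes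
    [B1 P u] the greatest [accel_ok] vector below [u]; the other sweeps are extremal in the same
    sense. *)
Lemma le_B1 w u : accel_ok w -> vle w u -> vle w (B1 P u).
Proof.
move=> w_ok /vleP wu; apply/vleP; apply: lohi_ind => [|j IHj].
  by rewrite sweep_up_first.
rewrite sweep_up_next le_min wu /=; apply: le_trans (w_ok j) _.
by rewrite lerD2r ell_homo.
Qed.

Lemma B2_le u : vle (B2 P u) u.
Proof.
apply/vleP; apply: loP => [|j]; first by rewrite sweep_down_last.
by rewrite sweep_down_prev ge_min lexx.
Qed.

Lemma B2_decel u : decel_ok (B2 P u).
Proof.
move=> j; rewrite lerBlDr lerBlDr addrAC mulrC -ler_pdivlMr ?K_gt0 //.
by rewrite sweep_down_prev ge_min lexx orbT.
Qed.

Lemma le_B2 w u : decel_ok w -> vle w u -> vle w (B2 P u).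
Proof.
move=> w_ok /vleP wu; apply/vleP; apply: hilo_ind => [|j IHj].
  by rewrite sweep_down_last.
rewrite sweep_down_prev le_min wu /= ler_pdivlMr ?K_gt0 // mulrC.
by have := w_ok j; move: IHj; rewrite /B2; lra.
Qed.

Lemma B3_ge l : vle l (B3 P l).
Proof.
apply/vleP; apply: loP => [|j]; first by rewrite sweep_down_last.
by have [] := B3_step l j.
Qed.

Lemma B3_accel l : accel_ok (B3 P l).
Proof. by move=> j; rewrite lerBrDr; have [] := B3_step l j. Qed.

Lemma B3_le w l : accel_ok w -> vle l w -> vle (B3 P l) w.
Proof.
move=> w_ok /vleP lw; apply/vleP; apply: hilo_ind => [|j IHj].
  by rewrite sweep_down_last.
(* The entry of [w] is itself a candidate in the minimization, by the induction hypothesis and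
   [w_ok]. *)
have [_ _] := B3_step l j; apply=> //.
by rewrite -lerBrDr; apply: le_trans IHj (w_ok j).
Qed.

Lemma B4_ge l : vle l (B4 P l).
Proof.
apply/vleP; apply: hiP => [|j]; first by rewrite sweep_up_first.
by rewrite sweep_up_next le_max lexx.
Qed.

Lemma B4_decel l : decel_ok (B4 P l).
Proof. by move=> j; rewrite sweep_up_next le_max lexx orbT. Qed.

Lemma B4_le w l : decel_ok w -> vle l w -> vle (B4 P l) w.
Proof.
move=> w_ok /vleP lw; apply/vleP; apply: lohi_ind => [|j IHj].
  by rewrite sweep_up_first.
rewrite sweep_up_next ge_max lw /=; apply: le_trans (w_ok j).
by rewrite !lerD2r ler_pM2l ?K_gt0.
Qed.

(** * Iterates and their limits *)

(** Two sequences are needed: the second sweep of an iteration may destroy the acceleration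
    constraint enforced by the first, which survives only between consecutive iterates. *)
Lemma accel_lim (a b : nat -> 'rV[R]_m.+2) s :
    (forall i, a k 0 i @[k --> \oo] --> s 0 i) ->
    (forall i, b k 0 i @[k --> \oo] --> s 0 i) ->
    (forall k j, a k 0 (hi j) <= ell P j (b k 0 (lo j)) - h * theta P j) ->
  accel_ok s.
Proof.
move=> a_s b_s ab j; apply: (ler_cvg_to (a_s (hi j)) _ (nearW _ (ab^~ j))).
by apply: cvgB (cvg_cst _); apply: continuous_cvg; [exact: ell_continuous|].
Qed.

Lemma decel_lim (a : nat -> 'rV[R]_m.+2) s :
    (forall i, a k 0 i @[k --> \oo] --> s 0 i) -> (forall k, decel_ok (a k)) ->
  decel_ok s.
Proof.
move=> a_s a_ok j; apply: (ler_cvg_to _ (a_s (hi j)) (nearW _ (a_ok^~ j))).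
by do 2!apply: cvgB (cvg_cst _); apply: cvgM (cvg_cst _) _.
Qed.

(** The iterates with the stopping tests ignored; index [k] is the pair numbered [k.+1] in the
    algorithm. *)
Definition upper k := iter k (fun u => B2 P (B1 P u)) (wmax P).
Definition lower k := iter k (fun l => B4 P (B3 P l)) (wmin P).

Lemma upper_le k : vle (upper k.+1) (upper k).
Proof. exact: vle_trans (B2_le _) (B1_le _). Qed.

Lemma lower_ge k : vle (lower k) (lower k.+1).
Proof. exact: vle_trans (B3_ge _) (B4_ge _). Qed.

Lemma le_upper w : (X2 P `&` X4 P) w -> forall k, vle w (upper k).
Proof.
case=> -[/accel_okP w_acc w_le] [/decel_okP w_dec _].
by elim=> [//|k IHk]; apply/le_B2/le_B1.
Qed.

Lemma lower_le w : (X1 P `&` X3 P) w -> forall k, vle (lower k) w.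
Proof.
case=> -[/accel_okP w_acc w_ge] [/decel_okP w_dec _].
by elim=> [//|k IHk]; apply/B4_le/B3_le.
Qed.

Lemma upper_le_wmax k : vle (upper k) (wmax P).
Proof.
elim: k => [|k IHk]; first exact: vle_refl.
exact: vle_trans (upper_le k) IHk.
Qed.

Lemma lower_ge_wmin k : vle (wmin P) (lower k).
Proof.
elim: k => [|k IHk]; first exact: vle_refl.
exact: vle_trans IHk (lower_ge k).
Qed.

Lemma upper_lim s :
  (forall i, upper k 0 i @[k --> \oo] --> s 0 i) -> (X2 P `&` X4 P) s.
Proof.
move=> us; have uSs i : upper k.+1 0 i @[k --> \oo] --> s 0 i.
  by rewrite (cvg_shiftS (fun k => upper k 0 i)).
have s_le : vle s (wmax P).
  apply/vleP => i; apply: (ler_cvg_to (us i) (cvg_cst _)).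
  by apply: nearW => k; apply: (vleP _ _ (upper_le_wmax k)).
have s_acc : accel_ok s.
  apply: (accel_lim uSs us) => k j.
  (* The later entry comes from the new iterate, below [B1], and the earlier one from the old
     iterate, above [B1]. *)
  apply: le_trans (vleP _ _ (B2_le _) _) _; apply: le_trans (B1_accel _ j) _.
  by rewrite lerD2r ell_homo // (vleP _ _ (B1_le _)).
have s_dec : decel_ok s by apply: (decel_lim uSs) => k; apply: B2_decel.
by split; split => //; [apply/accel_okP|apply/decel_okP].
Qed.

Lemma lower_lim s :
  (forall i, lower k 0 i @[k --> \oo] --> s 0 i) -> (X1 P `&` X3 P) s.
Proof.
move=> ls; have lSs i : lower k.+1 0 i @[k --> \oo] --> s 0 i.
  by rewrite (cvg_shiftS (fun k => lower k 0 i)).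
have s_ge : vle (wmin P) s.
  apply/vleP => i; apply: (ler_cvg_to (cvg_cst _) (ls i)).
  by apply: nearW => k; apply: (vleP _ _ (lower_ge_wmin k)).
have s_acc : accel_ok s.
  apply: (accel_lim ls lSs) => k j.
  apply: le_trans (vleP _ _ (B3_ge _) _) _; apply: le_trans (B3_accel _ j) _.
  by rewrite lerD2r ell_homo // (vleP _ _ (B4_ge _)).
have s_dec : decel_ok s by apply: (decel_lim lSs) => k; apply: B4_decel.
by split; split => //; [apply/accel_okP|apply/decel_okP].
Qed.

Lemma upper_fix k : upper k.+1 = upper k -> (X2 P `&` X4 P) (upper k).
Proof.
move=> fixk; have stat n : upper (n + k) = upper k.
  by elim: n => // n IHn; rewrite -[RHS]fixk /upper addSn !iterS -/(upper _) IHn.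
(* Only the tail matters, and after a shift by [k] it is constant. *)
apply: upper_lim => i; rewrite -(cvg_shiftn k).
by under eq_fun do rewrite stat; apply: cvg_cst.
Qed.

Lemma lower_fix k : lower k.+1 = lower k -> (X1 P `&` X3 P) (lower k).
Proof.
move=> fixk; have stat n : lower (n + k) = lower k.
  by elim: n => // n IHn; rewrite -[RHS]fixk /lower addSn !iterS -/(lower _) IHn.
apply: lower_lim => i; rewrite -(cvg_shiftn k).
by under eq_fun do rewrite stat; apply: cvg_cst.
Qed.

(** * Runs of the algorithm *)

Lemma algorithm_trichotomy halt k :
  [\/ algorithm P halt 0 k = Running (upper k) (lower k),
      exists n, [/\ upper n.+1 = upper n, lower n.+1 = lower n &
                  algorithm P halt 0 k = Returned (upper n) (lower n)] |
      [/\ halt, algorithm P halt 0 k = DeclaredEmpty &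
          exists n, ~~ vle (lower n) (upper n)]].
Proof.
elim: k => [|k [run|[n [un ln ret]]|[halts stop ul]]].
- exact: Or31.
- rewrite /= run /iteration.
  case: ifP => [/andP[du dl]|_].
    apply: Or32; exists k.
    have eq_u : upper k.+1 = upper k.
      by apply/eqP; rewrite -subr_eq0 -normr_le0.
    have eq_l : lower k.+1 = lower k.
      by apply/eqP; rewrite -subr_eq0 -normr_le0.
    (* The returned pair is number [k.+1], which for zero tolerance equals number [k]. *)
    by split=> //; rewrite -[in RHS]eq_u -[in RHS]eq_l.
  case: ifP => [/andP[halts nle]|_]; last exact: Or31.
  by apply: Or33; split=> //; exists k.+1.
- by apply: Or32; exists n; rewrite /= ret.
- by apply: Or33; rewrite /= stop.
Qed.

End Bounds.

Theorem proposition3p4 (R : realType) (m : nat) (P : problem R m)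
    (n_ge3 : (3 <= m.+2)%N)
    (h_gt0 : 0 < h P) (M_gt0 : 0 < M P) (Pmax_gt0 : 0 < Pmax P)
    (g_gt0 : 0 < g P) (mu_gt0 : 0 < mu P) (gamma_gt0 : 0 < gamma P)
    (c_ge0 : 0 <= c P)
    (alpha_bnd : forall i, - (pi / 2) < alpha P i < pi / 2)
    (what_gt0 : forall i, 0 < what P i)
    (whatE : forall i, Pmax P / (M P * Num.sqrt (2 * what P i))
                       = g P * mu P * cos (alpha P i))
    (h_small : forall i,
       0 <= 1 - h P * gamma P
            - h P * (Pmax P / (M P * (2 * what P i) `^ (3 / 2))))
    (win_ge0 : 0 <= win P) (wfin_ge0 : 0 <= wfin P)
    (wmax_ge0 : forall k, 0 <= wmax P 0 k)
    (wmax_first : wmax P 0 ord0 = win P)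
    (wmax_last : wmax P 0 ord_max = wfin P)
    (z y : 'rV[R]_m.+2)
    (zE : forall k, is_max [set w 0 k | w in X2 P `&` X4 P] (z 0 k))
    (yE : forall k, is_min [set w 0 k | w in X1 P `&` X3 P] (y 0 k))
    (halt : bool) :
  (exists k, algorithm P halt 0 k = Returned z y)
  \/ [/\ halt, (exists k, algorithm P halt 0 k = DeclaredEmpty) & X P = set0]
  \/ (exists u l : nat -> 'rV[R]_m.+2,
      [/\ forall k, algorithm P halt 0 k = Running (u k) (l k),
          (forall k, vle z (u k)) /\ u k @[k --> \oo] --> z
        & (forall k, vle (l k) y) /\ l k @[k --> \oo] --> y]).
Proof.
(* Each coordinate of [z] may a priori be attained by a different vector, so only bounds are
   extracted; feasibility of [z] is not presupposed. *)
have le_z w : (X2 P `&` X4 P) w -> vle w z.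
  by move=> Sw; apply/vleP => k; have [_] := zE k; apply; exists w.
have ge_y w : (X1 P `&` X3 P) w -> vle y w.
  by move=> Sw; apply/vleP => k; have [_] := yE k; apply; exists w.
have z_le k : vle z (upper P k).
  apply/vleP => i; have [[w Sw <-] _] := zE i.
  by apply: (vleP _ _ (le_upper h_gt0 M_gt0 Pmax_gt0 what_gt0 whatE h_small Sw k)).
have y_ge k : vle (lower P k) y.
  apply/vleP => i; have [[w Sw <-] _] := yE i.
  by apply: (vleP _ _ (lower_le h_gt0 M_gt0 Pmax_gt0 what_gt0 whatE h_small Sw k)).
have [run|/existsNP[k not_run]] :=
    pselect (forall k, algorithm P halt 0 k = Running (upper P k) (lower P k)).
  right; right; exists (upper P), (lower P); split=> //; split=> //.
    apply: cvg_nonincreasing_rV => // [k|s us]; first exact: upper_le.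
    exact/le_z/upper_lim.
  apply: cvg_nondecreasing_rV => // [k|s ls]; first exact: lower_ge.
  exact/ge_y/lower_lim.
(* The run leaves [Running] at step [k], so it has returned or declared emptiness by then. *)
have [//|[n [un ln ret]]|[halts stop [n nle]]] := algorithm_trichotomy P halt k.
  left; exists k; rewrite ret; congr Returned; apply: vle_anti => //.
    exact/le_z/upper_fix.
  exact/ge_y/lower_fix.
right; left; split=> //; first by exists k.
(* A point of [X] would give [lower n <= y <= w <= z <= upper n], against the failed comparison. *)
rewrite -subset0 => w [[[w1 w2] w3] w4].
have yw : vle y w by apply: ge_y.
have wz : vle w z by apply: le_z.
by move/negP: nle; apply;
  apply: vle_trans (y_ge n) (vle_trans yw (vle_trans wz (z_le n))).
Qed.
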